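(* Let $X$ be a compact connected Hausdorff space and let $\mathscr{F}=\{f_1,\dots,f_k\}$ be a finite set of continuous maps of $X$ to itself generating a forward minimal quasi-symmetric IFS. Then $X$ is a strict attractor of this IFS.
   Context: The IFS generated by $\mathscr{F}$ is quasi-symmetric if there is $f\in\mathscr{F}$ which is invertible with $f^{-1}\in\mathscr{F}$. It is forward minimal if the only non-empty closed set $B\subset X$ with $f_i(B)\subset B$ for all $i$ is $B=X$. $F(K)=\bigcup_{i=1}^k f_i(K)$ for non-empty compact $K\subset X$. $X$ is a strict attractor of the IFS if $\lim_{n\to\infty}F^n(K)=X$ in the Vietoris topology for all non-empty compact sets $K\subset X$. The Vietoris topology on the set $\mathscr{H}(X)$ of non-empty compact subsets is generated by the sets $\{K\in\mathscr{H}(X):K\subset U_1\cup\dots\cup U_m,\ K\cap U_i\ne\emptyset\text{ for all }i\}$ with $U_i$ open. *)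

(* Defs.v *)
From HB Require Import structures.
From mathcomp Require Import all_boot all_order all_algebra.
From mathcomp Require Import all_classical.
From mathcomp Require Import topology.

Set Implicit Arguments.
Unset Strict Implicit.
Unset Printing Implicit Defensive.

Local Open Scope classical_set_scope.

Record hyperspace (X : topologicalType) := Hyperspace {
  hset :> set X;
  hset_neq0 : hset !=set0;
  hset_compact : compact hset }.

HB.instance Definition _ (X : topologicalType) := gen_eqMixin (hyperspace X).
HB.instance Definition _ (X : topologicalType) :=
  gen_choiceMixin (hyperspace X).

(* Families of open sets U_1, ..., U_m, encoded as finite sets of sets;
   the empty family contributes only the empty set, since every K is
   nonempty. *)
Definition open_families (X : topologicalType) : set (set (set X)) :=
  [set Us | finite_set Us /\ Us `<=` open].

Definition vietoris_set (X : topologicalType) (Us : set (set X)) :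
    set (hyperspace X) :=
  [set K : hyperspace X | K `<=` \bigcup_(U in Us) U /\
                          forall U, Us U -> K `&` U !=set0].

HB.instance Definition _ (X : topologicalType) :=
  isSubBaseTopological.Build (hyperspace X)
    (@open_families X) (@vietoris_set X).

(* An IFS is a family f : 'I_k.+1 -> continuousType X X; it has at least one
   map, as otherwise F(K) would be empty. *)
Section IFS.
Variables (X : topologicalType) (k : nat) (f : 'I_k.+1 -> continuousType X X).

Definition quasi_symmetric :=
  exists i j, cancel (f i) (f j) /\ cancel (f j) (f i).

Definition forward_minimal :=
  forall B : set X, closed B -> B !=set0 ->
    (forall i, f i @` B `<=` B) -> B = [set: X].

Definition hutchinson_set (K : set X) : set X := \bigcup_i (f i @` K).

Lemma hutchinson_neq0 (K : hyperspace X) : hutchinson_set K !=set0.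
Proof. by have [x Kx] := hset_neq0 K; exists (f ord0 x), ord0 => //; exists x. Qed.

Lemma hutchinson_compact (K : hyperspace X) : compact (hutchinson_set K).
Proof.
have -> : hutchinson_set K = \big[setU/set0]_(i in 'I_k.+1) (f i @` K).
  by rewrite -bigcup_pred; congr bigcup; apply/seteqP.
apply: bigsetU_compact => i _; apply: continuous_compact; last first.
  exact: hset_compact.
exact/continuous_subspaceT/cts_fun.
Qed.

Definition hutchinson (K : hyperspace X) : hyperspace X :=
  Hyperspace (hutchinson_neq0 K) (@hutchinson_compact K).

(* L is A itself, viewed as a point of the hyperspace; it is not fixed before K
   because the empty space is allowed, where the hyperspace has no point. *)
Definition strict_attractor (A : set X) :=
  forall K : hyperspace X, exists2 L : hyperspace X,
    L = A :> set X & iter n hutchinson K @[n --> \oo] --> L.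

End IFS.

(* Main.v *)
(** Since the IFS contains a map and its inverse, [K `<=` F (F K)], so the even
    and the odd iterates of [K] both increase. Let [E] and [O] be the closures
    of their unions. Then [F E `<=` O] and [F O `<=` E], so [E `|` O] is closed
    and forward invariant, hence everything. By connectedness [E `&` O] is
    nonempty; it is also closed and forward invariant, hence everything too.
    So both the even and the odd iterates eventually meet every nonempty open
    set. *)
Require Import Defs.
From mathcomp Require Import all_boot all_order all_algebra.
From mathcomp Require Import finmap.
From mathcomp Require Import all_classical.
From mathcomp Require Import topology.

Local Open Scope classical_set_scope.

(** A basic neighbourhood of [L] is a finite intersection of subbasic sets. Each of these amounts to
    one containment in an open union and finitely many meeting conditions, so the filter [G] absorbs
    them all. *)
Lemma vietoris_cvg (X : topologicalType) (T : Type) (G : set_system T)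
    (FG : Filter G) (u : T -> hyperspace X) (L : hyperspace X) :
  (forall U : set X, open U -> L `<=` U -> \forall t \near G, u t `<=` U) ->
  (forall U : set X, open U -> L `&` U !=set0 ->
     \forall t \near G, u t `&` U !=set0) ->
  u t @[t --> G] --> L.
Proof.
move=> upper lower A; rewrite nbhsE => -[B [[D sD <-] [W DW WL]] BA].
suff GW : G (u @^-1` W) by apply: filterS GW => t Wt; apply: BA; exists W.
have [D' sD' WE] := sD _ DW; rewrite -WE in WL *.
rewrite preimage_bigcap; apply: filter_bigI => Us D'Us.
have /set_mem [finUs oUs] := sD' _ D'Us; have [subL meetL] := WL _ D'Us.
have Gupper : \forall t \near G, u t `<=` \bigcup_(U in Us) U.
  by apply: upper => //; apply: bigcup_open.
have Glower : G (\bigcap_(U in [set` fset_set Us]) (fun t => u t `&` U !=set0)).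
  apply: filter_bigI => U; rewrite in_fset_set// => /set_mem UsU.
  by apply: lower; [exact: oUs|exact: meetL].
apply: filterS2 Gupper Glower => t ut mt; split=> // U UsU.
by apply: mt; rewrite /= in_fset_set//; exact/mem_set.
Qed.

Section Hutchinson.
Variables (X : topologicalType) (k : nat) (f : 'I_k.+1 -> continuousType X X).
Implicit Types A B K : set X.
Local Notation F := (hutchinson_set f).

Lemma hset_iter_hutchinson (K : hyperspace X) n :
  iter n (hutchinson f) K = iter n F K :> set X.
Proof. by elim: n => //= n ->. Qed.

Lemma hutchinson_set_forward A : F A `<=` A -> forall i, f i @` A `<=` A.
Proof. by move=> FA i y fy; apply: FA; exists i. Qed.

Lemma hutchinson_setS A B : A `<=` B -> F A `<=` F B.
Proof. by move=> AB y [i _ [x Ax <-]]; exists i => //; exists x => //; exact: AB. Qed.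

(** By continuity, the preimage under [f i] of a neighbourhood of [f i x] is a neighbourhood of [x],
    hence meets [A]. *)
Lemma hutchinson_set_closure A : F (closure A) `<=` closure (F A).
Proof.
move=> _ [i _ [x clAx <-]] V /(@cts_fun _ _ (f i) x) /clAx [y [Ay Vy]].
by exists (f i y); split=> //; exists i => //; exists y.
Qed.

Definition parity_orbit K (b : bool) :=
  \bigcup_(n in [set n | odd n = b]) iter n F K.

(** Applying [F] raises the index of an iterate by one, which flips its parity. *)
Lemma hutchinson_closure_parity_orbit K b :
  F (closure (parity_orbit K b)) `<=` closure (parity_orbit K (~~ b)).
Proof.
apply: subset_trans (@hutchinson_set_closure _) _; apply: closureS.
move=> _ [i _ [x [n /= nb Kx] <-]]; exists n.+1; first by rewrite /= nb.
by exists i => //; exists x.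
Qed.

Lemma parity_orbit_neq0 K b : K !=set0 -> parity_orbit K b !=set0.
Proof.
move=> [x Kx]; case: b; last by exists x, 0.
by exists (f ord0 x), 1 => //; exists ord0 => //; exists x.
Qed.

Lemma parity_orbit_dense K b :
  connected [set: X] -> forward_minimal f -> K !=set0 ->
  closure (parity_orbit K b) = [set: X].
Proof.
move=> conX minF K0; pose C c := closure (parity_orbit K c).
have clC c : closed (C c) by exact: closed_closure.
have C0 c : C c !=set0.
  by have [x Kx] := @parity_orbit_neq0 _ c K0; exists x; exact: subset_closure.
have FC c : F (C c) `<=` C (~~ c) by exact: hutchinson_closure_parity_orbit.
have CU : C false `|` C true = [set: X].
  apply: minF; first exact: closedU.
    by have [x Cx] := C0 false; exists x; left.
  apply: hutchinson_set_forward => _ [i _ [x [] Cx <-]].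
    by right; apply: (FC false); exists i => //; exists x.
  by left; apply: (FC true); exists i => //; exists x.
have CI0 : C false `&` C true !=set0.
  apply: contrapT => /nonemptyPn CI0.
  (* If disjoint, the two closed sets are complementary, so [C false] is clopen and nonempty;
     connectedness makes it the whole space, which leaves no point for [C true]. *)
  have CT : C false = [set: X].
    apply: conX => //; [exists (~` C true)|exists (C false)];
      rewrite ?setTI ?openC//.
    apply/seteqP; split=> x Cx; first by move=> C1x; have : set0 x by rewrite -CI0.
    by have : [set: X] x by []; rewrite -CU => -[].
  by have [x Cx] := C0 true; have : set0 x by rewrite -CI0 CT.
have CI : C false `&` C true = [set: X].
  apply: minF => //; first exact: closedI.
  (* Each map exchanges the two closures, so it sends a common point to a common point. *)
  apply: hutchinson_set_forward => _ [i _ [x [Cx C'x] <-]].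
  by split; [apply: (FC true)|apply: (FC false)]; exists i => //; exists x.
apply/seteqP; split=> // x; rewrite -CI => -[Cx C'x].
by case: b.
Qed.

Lemma quasi_symmetric_sub2 K : quasi_symmetric f -> K `<=` F (F K).
Proof.
move=> [i [j [fK _]]] x Kx; exists j => //; exists (f i x) => //.
by exists i => //; exists x.
Qed.

Lemma iter_hutchinson_addn2 K n m :
  quasi_symmetric f -> iter n F K `<=` iter (m.*2 + n) F K.
Proof.
move=> qs; elim: m => // m IHm; apply: subset_trans IHm _.
exact: quasi_symmetric_sub2.
Qed.

Lemma iter_hutchinson_meets K (U : set X) :
  connected [set: X] -> forward_minimal f -> quasi_symmetric f ->
  K !=set0 -> open U -> U !=set0 ->
  \forall n \near \oo, iter n F K `&` U !=set0.
Proof.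
move=> conX minF qs K0 oU [x Ux].
have meet b : exists2 n, odd n = b & iter n F K `&` U !=set0.
  have : closure (parity_orbit K b) x by rewrite parity_orbit_dense.
  move=> /(_ U (open_nbhs_nbhs (conj oU Ux))) [y [[n nb Ky] Uy]].
  by exists n => //; exists y.
have [n0 n0e [y0 [Ky0 Uy0]]] := meet false.
have [n1 n1o [y1 [Ky1 Uy1]]] := meet true.
(* This bound dominates both indices, so the one with the parity of [n] is at most [n]. *)
exists (n0 + n1) => // n /= len.
(* Equal parity makes [n - m] even, so growth in steps of two carries [y] from the [m]-th iterate to
   the [n]-th. *)
have catch m y : odd n = odd m -> m <= n -> iter m F K y -> iter n F K y.
  move=> par mn Ky; have -> : n = ((n - m)./2.*2 + m)%N.
    by rewrite even_halfK ?subnK// oddB// par addbb.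
  exact: iter_hutchinson_addn2.
case nb : (odd n).
  exists y1; split=> //; apply: catch Ky1; first by rewrite nb.
  exact: leq_trans (leq_addl _ _) len.
exists y0; split=> //; apply: catch Ky0; first by rewrite nb.
exact: leq_trans (leq_addr _ _) len.
Qed.

End Hutchinson.

Theorem proposition3p7 (X : topologicalType) (k : nat)
    (f : 'I_k.+1 -> continuousType X X) :
  compact [set: X] -> connected [set: X] -> hausdorff_space X ->
  forward_minimal f -> quasi_symmetric f ->
  strict_attractor f [set: X].
Proof.
move=> cX conX _ minF qs K; have K0 := @hset_neq0 _ K.
have X0 : [set: X] !=set0 by have [x _] := K0; exists x.
exists (Hyperspace X0 cX) => //; apply: vietoris_cvg => /= U oU.
  (* An open set containing the whole space contains every iterate; only the meeting condition has
     content. *)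
  by move=> TU; apply: nearW => n x _; exact: TU.
rewrite setTI => U0; have := @iter_hutchinson_meets _ _ f K U conX minF qs K0 oU U0.
by apply: filterS => n; rewrite hset_iter_hutchinson.
Qed.
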